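(* Let $G$ be the hexagonal grid and let $X \subseteq V(G)$ be an identifying code in $G$. Then $\delta(X) \geq \frac{23}{55}$.
   Context: The hexagonal grid is the infinite $3$-regular plane graph (honeycomb lattice) all of whose faces are hexagons. For a vertex $v$, $N(v)$ is the set of neighbours of $v$ and $N[v] = N(v)\cup\{v\}$. A set $X \subseteq V(G)$ is an identifying code if $N[v]\cap X \neq \varnothing$ for every $v \in V(G)$ and $N[u]\cap X \neq N[v]\cap X$ for all distinct $u,v \in V(G)$. For a vertex $v$ and integer $r\ge 0$, $B_r(v)$ denotes the set of vertices at graph distance at most $r$ from $v$. The density of $X$ is $\delta(X) = \limsup_{r\to\infty} \frac{|B_r(v_0)\cap X|}{|B_r(v_0)|}$ for a fixed vertex $v_0$ (the value does not depend on the choice of $v_0$). *)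

(* Defs.v *)
From HB Require Import structures.
From mathcomp Require Import all_boot all_order all_algebra finmap.
From mathcomp Require Import all_classical all_reals all_analysis.
From mathcomp Require Import zify.

Set Implicit Arguments.
Unset Strict Implicit.
Unset Printing Implicit Defensive.

Import Order.TTheory GRing.Theory Num.Theory.

Local Open Scope classical_set_scope.
Local Open Scope ring_scope.

Section Graph.
Context {V : choiceType}.
Implicit Types (adj : rel V) (u v : V) (X : set V) (r : nat).

Definition closed_nbhd adj v : set V := [set u | u = v \/ adj v u].

Definition identifying_code adj X : Prop :=
  (forall v, closed_nbhd adj v `&` X !=set0) /\
  (forall u v, u <> v ->
     closed_nbhd adj u `&` X <> closed_nbhd adj v `&` X).

(* Graph distance at most r from v: the end of a walk with at most r edges. *)
Definition graph_ball adj r v : set V :=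
  [set u | exists p : seq V, [/\ path adj v p, last v p = u & (size p <= r)%N]].

(* fset_set sends an infinite set to the empty fset; in a locally finite graph
   the balls are finite (for hex_adj, see finite_hex_ball below), so both
   cardinals are the genuine ones. The limsup is taken in \bar R. *)
Definition density (R : realType) adj v0 X : \bar R :=
  limn_esup (fun r : nat =>
    ((#|` fset_set (graph_ball adj r v0 `&` X)|)%:R /
     (#|` fset_set (graph_ball adj r v0)|)%:R)%:E).

End Graph.

(* Honeycomb lattice. For e1, e2 of equal length at angle pi/3, the vertex
   (a, b, false) sits at a e1 + b e2 and (a, b, true) at
   a e1 + b e2 + (e1 + e2) / 3. The edges join the points at minimal distance:
   from (a, b, false) they go in the directions (e1 + e2) / 3, (e2 - 2 e1) / 3
   and (e1 - 2 e2) / 3, three vectors of equal length at mutual angles 2 pi/3. *)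
Definition hex_vertex : Type := (int * int * bool)%type.
HB.instance Definition _ := Choice.on hex_vertex.

Definition hex_adj : rel hex_vertex := fun u v =>
  match u, v with
  | (a, b, false), (c, d, true)
  | (c, d, true), (a, b, false) =>
      (c, d) \in [:: (a, b); (a - 1, b); (a, b - 1)]
  | _, _ => false
  end.

Definition hex_neighbours (u : hex_vertex) : seq hex_vertex :=
  match u with
  | (a, b, false) => [:: (a, b, true); (a - 1, b, true); (a, b - 1, true)]
  | (a, b, true) => [:: (a, b, false); (a + 1, b, false); (a, b + 1, false)]
  end.

Lemma hex_adj_sym : symmetric hex_adj.
Proof. by move=> [[a b] []] [[c d] []]. Qed.

Lemma hex_adj_irr : irreflexive hex_adj.
Proof. by move=> [[a b] []]. Qed.

Lemma hex_adjE (u v : hex_vertex) : hex_adj u v = (v \in hex_neighbours u).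
Proof.
by move: u v => [[a b] []] [[c d] []]; rewrite /= !inE !xpair_eqE; lia.
Qed.

Lemma hex_adj_3regular (u : hex_vertex) :
  uniq (hex_neighbours u) /\ size (hex_neighbours u) = 3%N.
Proof.
by move: u => [[a b] []]; split=> //; rewrite /= !inE !xpair_eqE; lia.
Qed.

Lemma finite_hex_ball (r : nat) (v : hex_vertex) :
  finite_set (graph_ball hex_adj r v).
Proof.
elim: r v => [|r IH] v.
  apply: (@sub_finite_set _ _ [set v]); last exact: finite_set1.
  by move=> u [[|w p] [_ /= <-]].
apply: (@sub_finite_set _ _
  ([set v] `|` \bigcup_(w in [set` hex_neighbours v]) graph_ball hex_adj r w)).
  move=> u [[|w p] /= []]; first by move=> _ <- _; left.
  rewrite hex_adjE => /andP[vw wp] pu pr; right; exists w => //.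
  by exists p.
rewrite finite_setU; split; first exact: finite_set1.
by apply: bigcup_finite => [|w _]; [exact: finite_seq | exact: IH].
Qed.

(* Main.v *)
(* Discharging, read as linear programming duality. A hexagon receives 3300 from
   each of its code vertices. Moreover, for every symmetry k fixing the hexagon
   and every j < 3, it receives a potential u_j read off the code on the pattern
   k S_j and pays the same potential read off on k S_j + k w_j. These transfers
   are differences between a function and its translate, so on a large ball they
   sum up to a boundary term. A branch and bound shows that whatever the code
   looks like within distance 2 of a hexagon, the hexagon ends up with at least
   8280. As all hexagons have 6 vertices and all vertices are on 3 hexagons, the
   density is at least 8280 / (6 * 3300) = 23/55, up to the boundary term, which
   is negligible for infinitely many radii because balls grow polynomially. *)
Require Import Defs.
From Stdlib Require Import ZArith FMapPositive.
From mathcomp Require Import all_boot all_order all_algebra finmap.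
From mathcomp Require Import all_classical all_reals all_analysis.
From mathcomp Require Import ssrZ zify lra.

Set Implicit Arguments.
Unset Strict Implicit.
Unset Printing Implicit Defensive.

Import Order.TTheory GRing.Theory Num.Theory.

Local Open Scope classical_set_scope.
Local Open Scope ring_scope.
Delimit Scope Z_scope with coqZ.

(** * Branch and bound over bit strings *)

(* A function of bits, as its minimum plus a sum of nonnegative increments along
   the branch of the trie; [Tskip] marks a bit on which it does not depend. *)
Inductive trie := Tend | Tskip of trie | Tnode of Z & Z & trie & trie.

Fixpoint trie_val (t : trie) (bs : seq bool) : Z :=
  match t, bs with
  | Tskip t', _ :: bs' => trie_val t' bs'
  | Tnode d0 d1 t0 t1, b :: bs' =>
      if b then Z.add d1 (trie_val t1 bs') else Z.add d0 (trie_val t0 bs')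
  | _, _ => Z0
  end.

(** [F] only receives the bits selected by the mask [m]. Its minimum is pulled out at the root, and
    each node stores by how much either choice of the bit raises the attainable minimum. *)
Fixpoint trie_of (m : seq bool) (F : seq bool -> Z) : Z * trie :=
  if ~~ has id m then (F [::], Tend) else
  match m with
  | true :: m' =>
      let: (z0, t0) := trie_of m' (fun q => F (false :: q)) in
      let: (z1, t1) := trie_of m' (fun q => F (true :: q)) in
      let z := Z.min z0 z1 in (z, Tnode (Z.sub z0 z) (Z.sub z1 z) t0 t1)
  | _ :: m' => let: (z, t) := trie_of m' F in (z, Tskip t)
  | [::] => (F [::], Tend)
  end.

Fixpoint trie_nonneg (t : trie) : Prop :=
  match t with
  | Tend => True
  | Tskip t' => trie_nonneg t'
  | Tnode d0 d1 t0 t1 =>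
      [/\ 0 <= d0, 0 <= d1, trie_nonneg t0 & trie_nonneg t1]
  end.

Lemma mask_has_false (m : seq bool) (T : Type) (s : seq T) :
  ~~ has id m -> mask m s = [::].
Proof. by elim: m s => [|[] m IH] [|x s] //=; apply: IH. Qed.

Lemma trie_ofE m F bs : size bs = size m ->
  Z.add (trie_of m F).1 (trie_val (trie_of m F).2 bs) = F (mask m bs).
Proof.
elim: m F bs => [|b m IH] F [|c bs] //=; first by move=> _; exact: Z.add_0_r.
move=> [sz].
case: ifP => [hm|_] /=.
  by have /= -> := @mask_has_false (b :: m) bool (c :: bs) hm; rewrite Z.add_0_r.
case: b => /=; last by case E: (trie_of m F) => [z t] /=; rewrite -IH // E.
case E0: (trie_of m _) => [z0 t0]; case E1: (trie_of m _) => [z1 t1] /=.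
have := IH (fun q => F (false :: q)) bs sz; have := IH (fun q => F (true :: q)) bs sz.
by rewrite E0 E1 /=; case: c; lia.
Qed.

Lemma trie_of_nonneg m F : trie_nonneg (trie_of m F).2.
Proof.
elim: m F => [|b m IH] F //=; case: ifP => // _.
case: b => /=; last by case E: (trie_of m F) => [z t] /=; have := IH F; rewrite E.
case E0: (trie_of m _) => [z0 t0]; case E1: (trie_of m _) => [z1 t1] /=.
split; [lia|lia| |].
  by have := IH (fun q => F (false :: q)); rewrite E0.
by have := IH (fun q => F (true :: q)); rewrite E1.
Qed.

Lemma trie_val_ge0 t bs : trie_nonneg t -> (0 <= trie_val t bs).
Proof.
elim: t bs => [|t IH|d0 d1 t0 IH0 t1 IH1] [|b bs] //=; try lia.
- exact: IH.
- by case=> h0 h1 /(IH0 bs) ? /(IH1 bs) ?; case: b; lia.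
Qed.

Definition trie_sum (ts : seq trie) (bs : seq bool) : Z :=
  foldr (fun t z => Z.add (trie_val t bs) z) Z0 ts.

Fixpoint all_nonneg (ts : seq trie) : Prop :=
  if ts is t :: ts' then trie_nonneg t /\ all_nonneg ts' else True.

Lemma trie_sum_ge0 ts bs : all_nonneg ts -> (0 <= trie_sum ts bs).
Proof. by elim: ts => [|t ts IH] //= [/(@trie_val_ge0 t bs) ? /IH ?]; lia. Qed.

(** Reading a bit cashes in the increments of all tries at once, so the sum of the tries minus [z]
    stays the same. Exhausted tries are dropped; [acc] reverses the order, which does not affect the
    sum. *)
Fixpoint advance (b : bool) (ts acc : seq trie) (z : Z) : seq trie * Z :=
  match ts with
  | [::] => (acc, z)
  | Tend :: ts' => advance b ts' acc z
  | Tskip t :: ts' => advance b ts' (t :: acc) z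
  | Tnode d0 d1 t0 t1 :: ts' =>
      if b then advance b ts' (t1 :: acc) (Z.sub z d1)
      else advance b ts' (t0 :: acc) (Z.sub z d0)
  end.

Lemma advanceE b ts acc z bs :
  Z.sub (trie_sum (advance b ts acc z).1 bs) (advance b ts acc z).2 =
  Z.sub (Z.add (trie_sum ts (b :: bs)) (trie_sum acc bs)) z.
Proof.
elim: ts acc z => [|[|t|d0 d1 t0 t1] ts IH] acc z /=; first lia.
- by rewrite IH; lia.
- by rewrite IH /=; lia.
- by case: b IH => IH; rewrite IH /=; lia.
Qed.

Lemma advance_nonneg b ts acc z : all_nonneg ts -> all_nonneg acc ->
  all_nonneg (advance b ts acc z).1.
Proof.
elim: ts acc z => [|[|t|d0 d1 t0 t1] ts IH] acc z //= [].
- by move=> _ hts hacc; apply: IH.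
- by move=> ht hts hacc; apply: IH.
- by case=> _ _ h0 h1 hts hacc; case: b IH => IH; apply: IH.
Qed.

(* The bits read so far are stored last first, and a clause decided by the bit i
   lists the offsets into them of its other literals. *)
Definition falsified (pre : seq bool) (c : seq nat) := ~~ has (nth false pre) c.

(* [z] is the part of the lower bound that the increments have still to reach;
   the only branches cut are those where it is reached. *)
Fixpoint search (lv : seq (seq (seq nat))) (pre : seq bool) (ts : seq trie)
    (z : Z) : bool :=
  if Z.leb z Z0 then true else
  match lv with
  | [::] => false
  | cl :: lv' =>
      (if has (falsified pre) cl then true
       else let: (ts0, z0) := advance false ts [::] z in
            search lv' (false :: pre) ts0 z0)
      && (let: (ts1, z1) := advance true ts [::] z in
          search lv' (true :: pre) ts1 z1)
  end.

(** All literals are positive, so a true bit satisfies every clause of its level and only a false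
    bit calls for a check. *)
Fixpoint admissible (lv : seq (seq (seq nat))) (pre bs : seq bool) : bool :=
  match lv, bs with
  | cl :: lv', b :: bs' =>
      (b || ~~ has (falsified pre) cl) && admissible lv' (b :: pre) bs'
  | _, _ => true
  end.

(** Induction along the branch [bs]: [advanceE] carries the inequality back over one bit,
    nonnegativity settles the stops with [z <= 0], and branches cut by a clause are not
    admissible. *)
Lemma searchP lv pre ts z bs : search lv pre ts z -> all_nonneg ts ->
  size bs = size lv -> admissible lv pre bs -> (z <= trie_sum ts bs).
Proof.
elim: lv pre ts z bs => [|cl lv IH] pre ts z bs /=;
  case: Z.leb_spec => //= hz; try by move=> _ /(@trie_sum_ge0 ts bs); lia.
case: bs => [|b bs] //= /andP[s0 s1] nn [sz] /andP[hb adm].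
case: b hb adm => /= hb adm.
  have := @advanceE true ts [::] z bs; have := @advance_nonneg true ts [::] z nn I.
  case: (advance _ _ _ _) s1 => [ts1 z1] /= s1 nn1; have := IH _ _ _ _ s1 nn1 sz adm.
  lia.
rewrite (negbTE hb) in s0.
have := @advanceE false ts [::] z bs; have := @advance_nonneg false ts [::] z nn I.
case: (advance _ _ _ _) s0 => [ts0 z0] /= s0 nn0; have := IH _ _ _ _ s0 nn0 sz adm.
lia.
Qed.

(** The bits [cs] will be those of the hexagon. Ignoring the clauses decided within them only makes
    the check stricter. *)
Fixpoint search_from (cs : seq bool) (lv : seq (seq (seq nat))) (pre : seq bool)
    (ts : seq trie) (z : Z) : bool :=
  match cs, lv with
  | c :: cs', _ :: lv' =>
      let: (ts', z') := advance c ts [::] z in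
      search_from cs' lv' (c :: pre) ts' z'
  | _, _ => search lv pre ts z
  end.

Lemma search_fromP cs lv pre ts z bs : search_from cs lv pre ts z ->
  all_nonneg ts -> size bs = size lv -> take (size cs) bs = cs ->
  admissible lv pre bs -> (z <= trie_sum ts bs).
Proof.
elim: cs lv pre ts z bs => [|c cs IH] lv pre ts z bs.
  by move=> h nn sz _; exact: (searchP h nn sz).
case: lv bs => [|cl lv] [|b bs] //= h nn [sz] [ec tk] /andP[_ adm].
move: h; rewrite -ec in adm *.
have := @advanceE b ts [::] z bs; have := @advance_nonneg b ts [::] z nn I.
case: (advance _ _ _ _) => [ts1 z1] /= nn1 e s1; have := IH _ _ _ _ _ s1 nn1 sz tk adm.
lia.
Qed.

(** A clause is decided by its largest index [i]. Among the bits 0, ..., i - 1 stored last first,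
    bit [j] has position i - 1 - j. *)
Definition clause_levels (n : nat) (cls : seq (seq nat)) : seq (seq (seq nat)) :=
  [seq [seq [seq (i.-1 - j)%N | j <- c & j != i] | c <- cls & foldr maxn 0 c == i]
  | i <- iota 0 n].

Lemma admissible_levels n cls bs : size bs = n ->
  all (has (nth false bs)) cls -> admissible (clause_levels n cls) [::] bs.
Proof.
move=> sz /allP hcls.
(* [k] counts the bits still to be read. *)
suff gen k : (k <= n)%N ->
    admissible [seq [seq [seq (i.-1 - j)%N | j <- c & j != i]
      | c <- cls & foldr maxn 0 c == i] | i <- iota (n - k)%N k]
      (rev (take (n - k)%N bs)) (drop (n - k)%N bs).
  by have := gen n (leqnn n); rewrite subnn take0 drop0.
elim: k => [|k IH] kn //=.
have lt : (n - k.+1 < size bs)%N by rewrite sz; lia.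
rewrite (drop_nth false lt) /=.
have <- : (n - k)%N = (n - k.+1).+1 by lia.
have /IH : (k <= n)%N by lia.
rewrite [in take _ _](_ : (n - k)%N = (n - k.+1).+1) ?(take_nth false) //; last by lia.
rewrite rev_rcons => ->; rewrite andbT.
case Eb: (nth false bs (n - k.+1)) => //=.
apply/hasPn => c' /mapP[c]; rewrite mem_filter => /andP[/eqP mx cin] ->.
rewrite /falsified negbK.
(* The deciding bit is false, so the literal that satisfies the clause has a smaller index and was
   already read. *)
have /hasP[j jc hj] := hcls _ cin.
have jle : (j <= n - k.+1)%N.
  by rewrite -mx; elim: c jc {cin mx} => //= a c IHc; rewrite inE => /orP[/eqP->|/IHc]; lia.
have jne : j != (n - k.+1)%N by apply/eqP => e; rewrite e Eb in hj.
apply/hasP; exists ((n - k.+1).-1 - j)%N; first by apply: map_f; rewrite mem_filter jne.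
rewrite nth_rev; last by rewrite size_takel; lia.
rewrite size_takel; last by lia.
rewrite nth_take; last by lia.
by rewrite (_ : (n - k.+1 - ((n - k.+1).-1 - j).+1)%N = j) //; lia.
Qed.

Lemma nth_mask_rank (m bs : seq bool) i : size bs = size m -> nth false m i ->
  nth false (mask m bs) (count id (take i m)) = nth false bs i.
Proof.
elim: m bs i => [|b m IH] bs i; first by rewrite nth_nil.
case: bs i => [|c bs] [|i] //=; first by move=> _ ->.
by move=> [sz] hi; case: b => /=; rewrite ?add1n ?add0n /= IH.
Qed.

(** * Patterns around a hexagon *)

(* [turn] and [flip] generate the symmetry group of [hexagon]: the rotation by
   pi / 3 about its centre and a reflection. *)
Definition turn (v : hex_vertex) : hex_vertex :=
  let: (a, b, t) := v in (- b, a + b - (~~ t)%:Z, ~~ t).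

Definition flip (v : hex_vertex) : hex_vertex :=
  let: (a, b, t) := v in (b + 1, a - 1, t).

Definition translate (w : int * int) (v : hex_vertex) : hex_vertex :=
  let: (a, b, t) := v in (a + w.1, b + w.2, t).

Definition closed_nbrs (v : hex_vertex) : seq hex_vertex := v :: hex_neighbours v.

(** The symmetric difference of the closed neighbourhoods: a code distinguishes [u] and [v] exactly
    when it meets this set. *)
Definition separators (u v : hex_vertex) : seq hex_vertex :=
  [seq w <- closed_nbrs u | w \notin closed_nbrs v] ++
  [seq w <- closed_nbrs v | w \notin closed_nbrs u].

Definition is_code (chi : hex_vertex -> bool) : Prop :=
  (forall v, has chi (closed_nbrs v)) /\
  (forall u v, u != v -> has chi (separators u v)).

(* The 24 vertices at distance at most 2 from the hexagon 0, which comes first;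
   the order keeps the branch and bound small. *)
Definition window : seq hex_vertex := [::
  (0, 0, false); (0, - 1, true); (1, - 1, false); (1, - 1, true);
  (1, 0, false); (0, 0, true); (- 1, 0, true); (0, - 1, false);
  (1, - 2, true); (2, - 1, false); (1, 0, true); (0, 1, false);
  (- 1, 1, false); (- 1, 0, false); (- 1, - 1, true); (0, - 2, true);
  (1, - 2, false); (2, - 2, false); (2, - 2, true); (2, - 1, true);
  (2, 0, false); (1, 1, false); (0, 1, true); (- 1, 1, true)].

(** Listed in cyclic order, so that [turn] shifts the list by one. *)
Definition hexagon : seq hex_vertex := take 6 window.

(* The two hexagons c and c - (1, 0) without their common edge. *)
Definition pattern0 : seq hex_vertex := [::
  (- 1, 0, false); (- 1, - 1, true); (- 1, 0, true); (0, - 1, false);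
  (0, 0, true); (1, - 1, false); (1, 0, false); (1, - 1, true)].

(* An entry (q, z) gives potential z to the pattern whose bits, most significant
   first, follow the leading 1 of q in binary; other patterns have potential 0.
   The values are an optimal dual solution, of value exactly 23/55, of the
   density linear program over the code patterns on the window. *)
Definition table0 : seq (Z * Z) := ([::
  (288, -68); (304, 336); (312, 358); (328, 22); (338, 498); (344, 448);
  (352, 308); (354, 564); (360, 252); (362, -336); (364, -486); (370, 510);
  (374, 684); (376, 288); (378, 28); (392, -142); (396, -642); (402, 174);
  (408, 96); (410, -44); (416, 194); (418, 654); (424, 572); (428, -52);
  (432, 624); (434, 738); (438, 222); (440, 678); (442, 478); (444, 144);
  (454, -42); (456, 334); (458, -54); (460, -26); (462, -54); (466, 840);
  (470, 526); (472, 538); (474, 522); (478, -168); (480, 444); (482, 712);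
  (483, 448); (486, 50); (488, 562); (490, -16); (492, 86); (494, -74);
  (496, 468); (498, 956); (499, 211); (502, 118); (504, 534); (506, 216);
  (507, 412); (508, -178); (510, -460)])%coqZ.

(* The two hexagons adjacent to both c and c - (2, -1). *)
Definition pattern1 : seq hex_vertex := [::
  (- 1, 0, false); (- 1, 1, false); (- 1, - 1, true); (- 1, 0, true);
  (- 1, 1, true); (0, - 1, false); (0, 0, false); (0, 1, false);
  (0, - 1, true); (0, 0, true)].
Definition table1 : seq (Z * Z) := ([::
  (1304, 74); (1314, -322); (1336, 128); (1346, -488); (1360, 454);
  (1362, -122); (1368, 140); (1378, -28); (1386, 324); (1392, 58);
  (1394, 122); (1400, 294); (1410, 208); (1416, 38); (1418, 76);
  (1426, 122); (1432, -498); (1434, -172); (1436, -144); (1442, -420);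
  (1446, -86); (1450, -198); (1458, -322); (1464, -266); (1466, -336);
  (1472, 430); (1474, -182); (1478, 76); (1480, 172); (1482, -192);
  (1488, 228); (1490, 580); (1492, 486); (1494, 578); (1496, -66);
  (1498, -584); (1500, 188); (1506, 96); (1510, 112); (1514, 76);
  (1518, 8); (1520, -2); (1522, -222); (1526, 372); (1528, 66);
  (1530, -230); (1544, 142); (1560, 56); (1564, 230); (1570, -160);
  (1578, -220); (1586, -338); (1592, 148); (1594, 322); (1600, 592);
  (1602, 128); (1608, 34); (1616, 902); (1618, 20); (1620, 932);
  (1624, 290); (1628, 152); (1634, 238); (1638, 512); (1642, 82);
  (1648, 98); (1650, 460); (1654, 54); (1656, 444); (1658, 12);
  (1666, 436); (1672, 412); (1688, -382); (1692, 16); (1698, -106);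
  (1702, 18); (1704, 50); (1706, -262); (1714, -246); (1720, -266);
  (1722, 138); (1724, -352); (1728, 360); (1730, -604); (1736, 144);
  (1738, -90); (1744, 616); (1746, -842); (1748, 426); (1752, 176);
  (1756, -232); (1760, 118); (1762, -104); (1766, -226); (1768, 300);
  (1770, 396); (1774, -404); (1776, 80); (1778, -76); (1780, 232);
  (1782, -24); (1784, -38); (1786, -402); (1788, 34); (1794, -206);
  (1798, -416); (1800, 224); (1802, -22); (1806, -312); (1810, -378);
  (1814, 294); (1816, -100); (1818, -42); (1820, 19); (1822, -46);
  (1826, -118); (1830, 182); (1834, -432); (1838, -122); (1842, 130);
  (1846, 258); (1848, 64); (1850, -186); (1854, 174); (1856, 244);
  (1858, -476); (1859, -300); (1862, -628); (1864, 62); (1866, 50);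
  (1870, 102); (1872, -454); (1874, -330); (1875, -404); (1876, 132);
  (1878, -224); (1880, 146); (1882, 130); (1884, 69); (1886, 160);
  (1890, 28); (1894, 88); (1898, 176); (1902, 600); (1904, -134);
  (1906, 232); (1907, -100); (1910, 658); (1912, 28); (1914, 162);
  (1918, 744); (1922, 78); (1923, 52); (1926, -274); (1928, 378);
  (1930, -368); (1934, -160); (1938, -36); (1942, 180); (1944, -26);
  (1946, -44); (1948, 274); (1950, -24); (1954, -132); (1955, -257);
  (1958, 412); (1960, 169); (1962, -108); (1963, 9); (1966, -374);
  (1970, 310); (1971, 136); (1974, 728); (1976, 120); (1978, -68);
  (1979, -736); (1980, 281); (1982, -318); (1984, -22); (1986, -362);
  (1987, -206); (1990, -456); (1992, -224); (1994, -112); (1995, -68);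
  (1998, 148); (2000, 74); (2002, -36); (2003, 326); (2004, 286);
  (2006, -128); (2008, 56); (2010, -724); (2012, -116); (2014, -322);
  (2016, -98); (2018, 124); (2019, 366); (2022, 158); (2024, -103);
  (2026, -336); (2027, -251); (2030, 678); (2032, 14); (2034, 92);
  (2035, 690); (2036, 253); (2038, 636); (2039, 424); (2040, 64);
  (2042, -240); (2043, 438); (2044, -285); (2046, 180)])%coqZ.

(* The hexagon between c and c - (2, 0), with two of its outer neighbours. *)
Definition pattern2 : seq hex_vertex := [::
  (- 1, 0, false); (- 1, 1, false); (- 1, - 1, true); (- 1, 0, true);
  (0, - 1, false); (0, 0, false); (0, - 2, true); (0, - 1, true)].
Definition table2 : seq (Z * Z) := ([::
  (304, 254); (308, 680); (352, -32); (356, 224); (360, -12); (364, -306);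
  (368, 274); (370, 362); (372, 466); (374, 56); (376, 604); (380, 242);
  (408, 54); (416, 120); (420, -10); (422, 444); (428, 278); (430, 356);
  (432, 128); (436, 246); (438, -158); (440, 420); (444, 472); (446, 162);
  (450, 134); (456, -90); (466, 62); (472, 162); (474, 766); (480, -358);
  (482, 47); (484, 72); (486, 132); (488, -180); (492, -194); (494, -282);
  (496, 400); (498, 92); (500, 512); (502, 104); (504, 810); (506, 360);
  (508, 600); (510, 600)])%coqZ.

Definition patterns : seq (nat * seq hex_vertex * (int * int)) :=
  [:: (0%N, pattern0, (1, 0)); (1%N, pattern1, (2, - 1)); (2%N, pattern2, (2, 0))].

(** The twelve symmetries are [turn] iterated after an optional [flip]. Displacements are
    transformed by the linear parts of these maps. *)
Definition moves : seq (nat * seq hex_vertex * (int * int)) :=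
  [seq (p.1.1,
        [seq iter k.1 turn (if k.2 then flip v else v) | v <- p.1.2],
        iter k.1 (fun w => (- w.2, w.1 + w.2))
          (if k.2 then (p.2.2, p.2.1) else p.2))
  | p <- patterns, k <- [seq (i, b) | i <- iota 0 6, b <- [:: false; true]]].

(** [true] marks a potential received, [false] one paid. *)
Definition terms : seq (bool * nat * seq hex_vertex) :=
  flatten [seq [:: (true, m.1.1, m.1.2); (false, m.1.1, map (translate m.2) m.1.2)]
          | m <- moves].

Definition max_potential : Z := 1000%coqZ.

(* Clipping makes the potentials bounded without inspecting the tables. *)
Definition lookup (t : PositiveMap.t Z) (q : seq bool) : Z :=
  let k := foldl (fun p (b : bool) => if b then xI p else xO p) xH q in
  if PositiveMap.find k t is Some z then
    Z.max (Z.opp max_potential) (Z.min max_potential z) else Z0.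

Definition map_of_table (t : seq (Z * Z)) : PositiveMap.t Z :=
  foldr (fun kz m => PositiveMap.add (Z.to_pos kz.1) kz.2 m) (PositiveMap.empty Z) t.

Definition potential_maps : seq (PositiveMap.t Z) :=
  map map_of_table [:: table0; table1; table2].

Definition potential (ms : seq (PositiveMap.t Z)) (j : nat) (q : seq bool) : Z :=
  lookup (nth (PositiveMap.empty Z) ms j) q.

Definition with_sign (s : bool) (z : Z) : Z := if s then z else Z.opp z.

Definition term_val (chi : hex_vertex -> bool) (d : bool * nat * seq hex_vertex) : Z :=
  with_sign d.1.1 (potential potential_maps d.1.2 (map chi d.2)).

(** The final charge of the hexagon 0; that of hexagon c is obtained by composing [chi] with
    [translate c]. *)
Definition hexagon_charge (chi : hex_vertex -> bool) : Z :=
  \sum_(v <- hexagon) (if chi v then 3300%coqZ else Z0) + \sum_(d <- terms) term_val chi d.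

(** * Reduction of the bound at one hexagon to a finite check *)

Definition six_bits (n : nat) : seq bool := [seq odd (n %/ 2 ^ i) | i <- iota 0 6].

(* One bit string of length 6 for each orbit under rotation. *)
Definition necklaces : seq (seq bool) :=
  map six_bits [:: 0; 1; 3; 5; 7; 9; 11; 13; 15; 21; 23; 27; 31; 63]%N.

(** Size at most 6 keeps the pairs at distance at most 2. Vertices further apart have disjoint
    closed neighbourhoods, so domination already separates them. *)
Definition window_clauses : seq (seq hex_vertex) :=
  [seq c <- [seq closed_nbrs v | v <- window] ++
      [seq separators (nth (0, 0, false) window ij.1) (nth (0, 0, false) window ij.2)
      | ij <- [seq (i, j) | j <- iota 0 24, i <- iota 0 j]]
  | all (mem window) c & (size c <= 6)%N].

Definition indices (s : seq hex_vertex) : seq nat := [seq index v window | v <- s].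

Definition index_mask (s : seq nat) : seq bool := [seq i \in s | i <- iota 0 24].

Definition indexed_terms : seq (bool * nat * seq nat) :=
  [seq (d.1, indices d.2) | d <- terms].

(** Terms reading the same vertices share one trie: the minimum of their sum is at least the sum of
    their minima. *)
Definition index_masks : seq (seq bool) := undup [seq index_mask d.2 | d <- indexed_terms].

(** An index is replaced by its rank in [g], its position once the mask is applied. *)
Definition terms_on (g : seq bool) : seq (bool * nat * seq nat) :=
  [seq (d.1, [seq count id (take i g) | i <- d.2]) | d <- indexed_terms & index_mask d.2 == g].

Definition local_val (ms : seq (PositiveMap.t Z)) (ds : seq (bool * nat * seq nat))
    (q : seq bool) : Z :=
  foldr (fun d z => Z.add (with_sign d.1.1 (potential ms d.1.2 (map (nth false q) d.2))) z) Z0 ds.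

Definition code_val (q : seq bool) : Z :=
  foldr (fun (b : bool) z => if b then Z.add 3300%coqZ z else z) Z0 q.

Definition tries : seq (Z * trie) :=
  let ms := potential_maps in
  trie_of (nseq 6 true ++ nseq 18 false) code_val ::
  [seq (let ds := terms_on g in trie_of g (local_val ms ds)) | g <- index_masks].

(** The minima of the tries are granted from the start; the increments have to supply what is
    missing to 8280. *)
Definition certificate : bool :=
  let ts := tries in
  let lv := clause_levels 24 (map indices window_clauses) in
  let z := Z.sub 8280%coqZ (foldr (fun t z => Z.add t.1 z) Z0 ts) in
  let ts' := map snd ts in
  all (fun cs => search_from cs lv [::] ts' z) necklaces.

Lemma certificate_ok : certificate = true.
Proof. by vm_compute. Qed.

(** * Invariance under symmetries of the grid *)

Lemma turn_inj : injective turn.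
Proof. by move=> [[a b] []] [[c d] []] // [] h1 h2; congr (_, _, _); lia. Qed.

Lemma mem_closed_nbrs u v : (u \in closed_nbrs v) =
  match u, v with
  | (a, b, false), (c, d, false) | (a, b, true), (c, d, true) => (a == c) && (b == d)
  | (a, b, true), (c, d, false) =>
      [|| (a == c) && (b == d), (a == c - 1) && (b == d) | (a == c) && (b == d - 1)]
  | (a, b, false), (c, d, true) =>
      [|| (a == c) && (b == d), (a == c + 1) && (b == d) | (a == c) && (b == d + 1)]
  end.
Proof.
by move: u v => [[a b] []] [[c d] []]; rewrite !inE !xpair_eqE /= ?andbT ?andbF ?orbF.
Qed.

Lemma mem_turn_closed_nbrs u v :
  (turn u \in closed_nbrs (turn v)) = (u \in closed_nbrs v).
Proof.
by rewrite !mem_closed_nbrs; move: u v => [[a b] []] [[c d] []] /=; lia.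
Qed.

Lemma mem_translate_closed_nbrs w u v :
  (translate w u \in closed_nbrs (translate w v)) = (u \in closed_nbrs v).
Proof.
by rewrite !mem_closed_nbrs; move: w u v => [i j] [[a b] []] [[c d] []] /=; lia.
Qed.

Lemma mem_separators u v w :
  (w \in separators u v) = (w \in closed_nbrs u) (+) (w \in closed_nbrs v).
Proof.
rewrite mem_cat !mem_filter.
by case: (w \in closed_nbrs u); case: (w \in closed_nbrs v).
Qed.

Lemma is_code_comp chi f g : cancel f g -> cancel g f ->
  (forall u v, (f u \in closed_nbrs (f v)) = (u \in closed_nbrs v)) ->
  is_code chi -> is_code (chi \o f).
Proof.
move=> fK gK hf [dom sep]; split=> [v|u v uv].
  have /hasP[w] := dom (f v); rewrite -(gK w) hf => hw hx.
  by apply/hasP; exists (g w).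
have : f u != f v by rewrite (can_eq fK).
move=> /sep /hasP[w]; rewrite -(gK w) mem_separators !hf -mem_separators => hw hx.
by apply/hasP; exists (g w).
Qed.

Definition unturn (v : hex_vertex) : hex_vertex := iter 5 turn v.

Lemma iter_turn6 v : iter 6 turn v = v.
Proof. by move: v => [[a b] []] /=; congr (_, _, _); lia. Qed.

Lemma is_code_turn chi : is_code chi -> is_code (chi \o turn).
Proof.
apply: (@is_code_comp chi turn unturn); last exact: mem_turn_closed_nbrs.
  by move=> v; rewrite -[RHS]iter_turn6 iterSr.
by move=> v; rewrite -[RHS]iter_turn6 iterS.
Qed.

Lemma is_code_translate chi w : is_code chi -> is_code (chi \o translate w).
Proof.
apply: (@is_code_comp chi (translate w) (translate (- w.1, - w.2))).
- by move: w => [i j] [[a b] t] /=; congr (_, _, _); lia.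
- by move: w => [i j] [[a b] t] /=; congr (_, _, _); lia.
- exact: mem_translate_closed_nbrs.
Qed.

(** The moves run over the whole symmetry group of the hexagon, which composition with [turn]
    permutes. *)
Lemma terms_turn :
  perm_eq [seq (d.1, map turn d.2) | d <- terms] terms.
Proof. by vm_compute. Qed.

Lemma hexagon_turn : map turn hexagon = seq.rot 1 hexagon.
Proof. by vm_compute. Qed.

Lemma hexagon_charge_turn chi : hexagon_charge (chi \o turn) = hexagon_charge chi.
Proof.
rewrite /hexagon_charge; congr (_ + _).
  transitivity (\sum_(v <- map turn hexagon) (if chi v then 3300%coqZ else Z0)).
    by rewrite big_map.
  by apply: perm_big; rewrite hexagon_turn perm_rot.
rewrite -[RHS](perm_big _ terms_turn) big_map; apply: eq_bigr => d _.
by rewrite /term_val /= -map_comp.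
Qed.

Lemma iter_turn_code chi i : is_code chi ->
  [/\ is_code (chi \o iter i turn),
      hexagon_charge (chi \o iter i turn) = hexagon_charge chi &
      map (chi \o iter i turn) hexagon = iter i (seq.rot 1) (map chi hexagon)].
Proof.
elim: i => [|i IH] hc; first by split.
have [hci ci mi] := IH hc; split.
- rewrite (_ : _ \o _ = (chi \o iter i turn) \o turn); first exact: is_code_turn.
  by apply: funext => v /=; rewrite -iterSr.
- rewrite -ci -[RHS]hexagon_charge_turn; congr hexagon_charge.
  by apply: funext => v /=; rewrite -iterSr.
- rewrite (_ : map _ _ = map (chi \o iter i turn) (map turn hexagon)).
    by rewrite hexagon_turn map_rot mi.
  by rewrite -map_comp; apply: eq_map => v /=; rewrite -iterSr.
Qed.

Lemma necklacesP (cs : seq bool) : size cs = 6%N ->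
  exists i, iter i (seq.rot 1) cs \in necklaces.
Proof.
case: cs => [|a [|b [|c [|d [|e [|f [|g cs]]]]]]] //= _.
suff : has (fun i => iter i (seq.rot 1) [:: a; b; c; d; e; f] \in necklaces) (iota 0 6).
  by case/hasP => i _ hi; exists i.
by case: a; case: b; case: c; case: d; case: e; case: f; vm_compute.
Qed.

(** * From the certificate to the bound at one hexagon *)

Lemma nth_window (chi : hex_vertex -> bool) v : v \in window ->
  nth false (map chi window) (index v window) = chi v.
Proof. by move=> vw; rewrite (nth_map v) ?nth_index // index_mem. Qed.

Lemma indices_window (c : seq hex_vertex) chi : {subset c <= window} ->
  map (nth false (map chi window)) (indices c) = map chi c.
Proof.
move=> cw; rewrite /indices -map_comp; apply/eq_in_map => v /cw vw.
exact: nth_window.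
Qed.

Lemma window_clauses_code chi : is_code chi ->
  all (has (nth false (map chi window))) (map indices window_clauses).
Proof.
move=> [dom sep]; apply/allP => ci /mapP[c]; rewrite mem_filter => /andP[/andP[cw _] hc] ->.
suff : has chi c.
  case/hasP => v vc hv; apply/hasP; exists (index v window); first exact: map_f.
  by rewrite nth_window //; exact: (allP cw).
move: hc; rewrite mem_cat => /orP[/mapP[v _ ->]|/mapP[[i j] hij ->]]; first exact: dom.
apply: sep; rewrite [(i, j).1]/= [(i, j).2]/=.
case/allpairsPdep: hij => j' [i' [hj hi [-> ->]]].
move: hj hi; rewrite !mem_iota !add0n => /andP[_ hj] /andP[_ hi].
have sw : size window = 24%N by [].
rewrite nth_uniq ?sw //; first by rewrite neq_ltn hi.
by apply: ltn_trans hi hj.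
Qed.

Lemma terms_sub_window d : d \in terms -> {subset d.2 <= window}.
Proof.
move=> dt; apply/allP; move: d dt; apply/allP.
by vm_compute.
Qed.

Lemma indexed_val chi d : d \in terms ->
  term_val chi d = with_sign d.1.1 (potential potential_maps d.1.2
    (map (nth false (map chi window)) (indices d.2))).
Proof. by move=> /terms_sub_window dw; rewrite indices_window. Qed.

Lemma big_by_support (f : bool * nat * seq nat -> Z) :
  \sum_(d <- indexed_terms) f d =
  \sum_(g <- index_masks) \sum_(d <- indexed_terms | index_mask d.2 == g) f d.
Proof.
rewrite [RHS](exchange_big_dep predT) //=; apply: eq_big_seq => d dt.
rewrite -big_filter (_ : [seq i <- index_masks | _] = [:: index_mask d.2]) ?big_seq1 //.
have hin : index_mask d.2 \in index_masks by rewrite mem_undup;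
    exact: (map_f (fun d : bool * nat * seq nat => index_mask d.2) dt).
rewrite (eq_filter (a2 := pred1 (index_mask d.2))); last by move=> g; rewrite /= eq_sym.
by rewrite filter_pred1_uniq // undup_uniq.
Qed.

Lemma local_valE g (bs : seq bool) : size bs = 24%N ->
  local_val potential_maps (terms_on g) (mask g bs) =
  \sum_(d <- indexed_terms | index_mask d.2 == g)
     with_sign d.1.1 (potential potential_maps d.1.2 (map (nth false bs) d.2)).
Proof.
move=> sz; rewrite /terms_on -big_filter.
have : all (fun d => all (fun i => i < 24)%N d.2) indexed_terms by vm_compute.
elim: indexed_terms => [|d s IH] /=; first by rewrite big_nil.
case/andP=> hd /IH {}IH; case: eqP => [e|_] //=.
rewrite big_cons -IH /=; congr (Z.add (with_sign _ (potential _ _ _)) _).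
rewrite -map_comp; apply/eq_in_map => i hi /=.
have i24 : (i < 24)%N := allP hd _ hi.
rewrite -e; apply: nth_mask_rank; first by rewrite size_map size_iota.
by rewrite (nth_map 0%N) ?size_iota // nth_iota.
Qed.

Lemma code_valE (cs : seq hex_vertex) chi :
  code_val (map chi cs) = \sum_(v <- cs) (if chi v then 3300%coqZ else Z0).
Proof.
elim: cs => [|v cs IH]; first by rewrite big_nil.
by rewrite big_cons -IH /=; case: (chi v) => //=; lia.
Qed.

Lemma big_tries chi :
  hexagon_charge chi = \sum_(t <- tries) Z.add t.1 (trie_val t.2 (map chi window)).
Proof.
rewrite /tries big_cons; congr (_ + _).
  by rewrite trie_ofE // -code_valE.
rewrite big_map (eq_big_seq (fun d => with_sign d.1.1 (potential potential_maps d.1.2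
    (map (nth false (map chi window)) (indices d.2))))); last first.
  by move=> d dt; rewrite indexed_val.
rewrite -(big_map (fun d => (d.1, indices d.2)) xpredT (fun d => with_sign d.1.1
  (potential potential_maps d.1.2 (map (nth false (map chi window)) d.2)))) -/indexed_terms.
rewrite big_by_support; apply: eq_big_seq => g gs.
have sz : size (map chi window) = 24%N by rewrite size_map.
have szg : size (map chi window) = size g.
  by move: gs; rewrite sz mem_undup => /mapP[d _ ->]; rewrite size_map size_iota.
by rewrite (trie_ofE _ szg) (local_valE _ sz).
Qed.

Lemma trie_sumE (ts : seq (Z * trie)) bs :
  \sum_(t <- ts) Z.add t.1 (trie_val t.2 bs) =
  Z.add (foldr (fun t z => Z.add t.1 z) Z0 ts) (trie_sum (map snd ts) bs).
Proof. by elim: ts => [|t ts IH]; rewrite ?big_nil // big_cons IH /=; lia. Qed.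

Lemma tries_nonneg : all_nonneg (map snd tries).
Proof.
rewrite /tries; split; first exact: trie_of_nonneg.
by elim: index_masks => //= g s IH; split=> //; exact: trie_of_nonneg.
Qed.

(** A rotation, which preserves both codes and charge, turns the bits of the hexagon into a listed
    necklace. The window then gives an admissible string with that prefix, to which the certificate
    applies. *)
Lemma hexagon_charge_ge chi : is_code chi -> (8280%coqZ <= hexagon_charge chi)%R.
Proof.
move=> hc0.
have [i hi] := @necklacesP (map chi hexagon) erefl.
have [hc <- mi] := iter_turn_code i hc0; move: hc mi hi.
set psi := chi \o _ => hc <- hi {hc0}.
have sz : size (map psi window) = 24%N by rewrite size_map.
have adm := admissible_levels sz (window_clauses_code hc).
have szl : size (map psi window) =
    size (clause_levels 24 (map indices window_clauses)).
  by rewrite sz size_map size_iota.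
have tk : take (size (map psi hexagon)) (map psi window) = map psi hexagon.
  by rewrite size_map -map_take.
have : is_true certificate by rewrite certificate_ok.
rewrite /certificate; cbv zeta => /allP/(_ _ hi) hs.
have := search_fromP hs tries_nonneg szl tk adm.
rewrite big_tries trie_sumE; lia.
Qed.

(** * Summation over balls *)

Lemma is_code_identifying (X : set hex_vertex) : identifying_code hex_adj X ->
  is_code (fun v => `[< X v >]).
Proof.
have nbE u v : (closed_nbhd hex_adj v u) <-> u \in closed_nbrs v.
  rewrite /closed_nbrs inE -hex_adjE; split.
    by case=> [->|->]; rewrite ?eqxx ?orbT.
  by case/orP => [/eqP|]; [left|right].
case=> dom sep; split=> [v|u v /eqP uv].
  have [w [/nbE wv Xw]] := dom v.
  by apply/hasP; exists w => //; apply/asboolP.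
apply: contrapT => /negP/hasPn h; apply: (sep u v uv).
rewrite eqEsubset; split=> w [/nbE wu Xw]; split=> //; apply/nbE; apply: contrapT => /negP wv.
  by have := h w; rewrite mem_separators wu (negbTE wv) => /(_ isT)/asboolP.
by have := h w; rewrite mem_separators wu (negbTE wv) => /(_ isT)/asboolP.
Qed.

(** * Boundary terms of sums of translates *)

Section Flow.
Variable V : eqType.
Implicit Types (s t : seq V) (F G : V -> Z).

Lemma sum_subseq s t F : uniq s -> uniq t -> {subset t <= s} ->
  (forall v, 0 <= F v) -> \sum_(v <- t) F v <= \sum_(v <- s) F v.
Proof.
move=> us ut ts F0; rewrite [leRHS](bigID (mem t)) /=.
have -> : \sum_(v <- s | v \in t) F v = \sum_(v <- t) F v.
  rewrite -big_filter; apply: perm_big; apply: uniq_perm => //; first exact: filter_uniq.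
  by move=> v; rewrite mem_filter; case vt : (v \in t) => //=; rewrite ts.
by rewrite lerDl; apply: sumr_ge0.
Qed.

Lemma sum_const s (c : Z) : \sum_(v <- s) c = c * Z.of_nat (size s).
Proof. elim: s => [|v s IH]; rewrite ?big_nil ?big_cons /= ?IH; lia. Qed.

(** Adding [M] makes the values range over [0, 2 M]. As [tau'] embeds [t] in [s], the translated sum
    over [s] is at least the sum over [t], and each element of [s] outside [t] costs at most 2 M. *)
Lemma flow_le s t (tau tau' : V -> V) G (M : Z) : uniq s -> uniq t -> {subset t <= s} ->
  cancel tau' tau -> (forall v, v \in t -> tau' v \in s) ->
  (forall v, - M <= G v <= M) ->
  \sum_(v <- s) G v - \sum_(v <- s) G (tau v) <=
    2 * M * (Z.of_nat (size s) - Z.of_nat (size t)).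
Proof.
move=> us ut ts tK hs GM; pose F v := G v + M.
have F0 v : 0 <= F v by have := GM v; rewrite /F; lia.
have F2 v : F v <= 2 * M by have := GM v; rewrite /F; lia.
have -> : \sum_(v <- s) G v - \sum_(v <- s) G (tau v) =
    \sum_(v <- s) F v - \sum_(v <- s) F (tau v).
  by rewrite /F !big_split /= opprD addrACA subrr addr0.
have h1 : \sum_(v <- t) F v <= \sum_(v <- s) F (tau v).
  have -> : \sum_(v <- t) F v = \sum_(v <- map tau' t) F (tau v).
    by rewrite big_map; apply: eq_bigr => v _; rewrite tK.
  apply: sum_subseq => // [|v /mapP[w wt ->]]; last exact: hs.
  by rewrite map_inj_uniq //; apply: can_inj tK.
have h2 : \sum_(v <- s) F v <= \sum_(v <- t) F v + 2 * M * (Z.of_nat (size s) - Z.of_nat (size t)).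
  have : \sum_(v <- t) (2 * M - F v) <= \sum_(v <- s) (2 * M - F v).
    by apply: sum_subseq => // v; have := F2 v; lia.
  rewrite !sumrB !sum_const.
  move: (\sum_(v <- t) F v) (\sum_(v <- s) F v) => a b.
  nia.
move: h1 h2; set a := \sum_(v <- t) _; set b := \sum_(v <- s) F v; set c := \sum_(v <- s) F _.
lia.
Qed.

Lemma sum_inj_le s t (P Q : pred V) (f : V -> V) F : uniq s -> uniq t ->
  injective f -> (forall v, v \in s -> P v -> (f v \in t) && Q (f v)) ->
  (forall v, 0 <= F v) ->
  \sum_(v <- s | P v) F (f v) <= \sum_(v <- t | Q v) F v.
Proof.
move=> us ut fi fst F0; rewrite -(big_filter s) -(big_filter t) -(big_map f xpredT).
apply: sum_subseq => //; try exact: filter_uniq.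
  by rewrite map_inj_uniq ?filter_uniq.
move=> w /mapP[v]; rewrite mem_filter => /andP[Pv vs] ->.
by rewrite mem_filter andbC fst.
Qed.
End Flow.

(* The indices c of the three hexagons [translate c hexagon] through a vertex. *)
Definition hexagons_at (v : hex_vertex) : seq (int * int) :=
  let: (a, b, t) := v in
  if t then [:: (a, b + 1); (a - 1, b + 1); (a, b)]
  else [:: (a, b); (a - 1, b + 1); (a - 1, b)].

(** Sums over hexagons are replaced by sums over [v] and [k < 3], in which each hexagon occurs once
    for each of its six vertices. The numbering by [k] commutes with translations. *)
Definition centre (k : nat) (v : hex_vertex) : int * int := nth (0, 0) (hexagons_at v) k.

Lemma centre_translate k w v : (k < 3)%N ->
  centre k (translate w v) = ((centre k v).1 + w.1, (centre k v).2 + w.2).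
Proof.
by move: w v => [i j] [[a b] []]; case: k => [|[|[|]]] //= _; congr (_, _); lia.
Qed.

Lemma translate_translate c w v : translate c (translate w v) = translate (w.1 + c.1, w.2 + c.2) v.
Proof. by move: v => [[a b] t]; rewrite /= !addrA. Qed.

(** A computable ball. Distance bounds are checked by computation at the two vertices of cell (0, 0)
    and translated. *)
Fixpoint reach (n : nat) (v : hex_vertex) : seq hex_vertex :=
  if n is n'.+1 then v :: flatten (map (reach n') (hex_neighbours v)) else [:: v].

Lemma hex_neighbours_translate w v :
  hex_neighbours (translate w v) = map (translate w) (hex_neighbours v).
Proof.
by move: w v => [i j] [[a b] []] /=; congr [:: (_, _, _); (_, _, _); (_, _, _)]; lia.
Qed.

Lemma reach_translate n w v : reach n (translate w v) = map (translate w) (reach n v).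
Proof.
elim: n v => [|n IH] v //=; congr (_ :: _).
rewrite hex_neighbours_translate map_flatten -!map_comp; congr flatten.
by apply: eq_map => u /=.
Qed.

Section Balls.
Variable v0 : hex_vertex.

Definition hex_ball (r : nat) : {fset hex_vertex} := fset_set (graph_ball hex_adj r v0).

Lemma in_hex_ball r v : (v \in hex_ball r) = (v \in graph_ball hex_adj r v0).
Proof. by rewrite in_fset_set //; exact: finite_hex_ball. Qed.

Lemma ball_mono r s v : (r <= s)%N -> v \in hex_ball r -> v \in hex_ball s.
Proof.
move=> rs; rewrite !in_hex_ball !inE => -[p [pp lp sp]].
by exists p; split=> //; apply: leq_trans rs.
Qed.

Lemma ball_adj r u v : u \in hex_ball r -> hex_adj u v -> v \in hex_ball r.+1.
Proof.
rewrite !in_hex_ball !inE => -[p [pp lp sp]] uv; exists (rcons p v).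
by rewrite rcons_path pp last_rcons size_rcons lp.
Qed.

Lemma ball_reach n r u v : u \in hex_ball r -> v \in reach n u -> v \in hex_ball (r + n).
Proof.
elim: n r u => [|n IH] r u ur /=; first by rewrite addn0 inE => /eqP->.
rewrite inE => /orP[/eqP->|]; first by apply: ball_mono ur; rewrite leq_addr.
case/flattenP => s /mapP[w wu ->] vw; rewrite addnS -addSn.
by apply: IH vw; apply: ball_adj ur _; rewrite hex_adjE.
Qed.

(** [v] lies on the hexagon, whose vertices are pairwise at distance at most 3. *)
Lemma ball_hexagon r k h v : (k < 3)%N -> h \in hexagon -> v \in hex_ball r ->
  translate (centre k v) h \in hex_ball (r + 3).
Proof.
move=> k3 hh /ball_reach; apply.
case: v => [[a b] t]; pose u : hex_vertex := (0, 0, t).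
have -> : (a, b, t) = translate (a, b) u by rewrite /= !add0r.
rewrite centre_translate // reach_translate.
rewrite (_ : translate _ h = translate (a, b) (translate (centre k u) h)); last first.
  by rewrite translate_translate.
apply: map_f.
have : all (fun k => all (fun t => all (fun h => translate (centre k (0, 0, t)) h
   \in reach 3 (0, 0, t)) hexagon) [:: true; false]) (iota 0 3) by vm_compute.
by move/allP/(_ k); rewrite mem_iota => /(_ k3)/allP/(_ t)/(_ _)/allP; apply; case: (t).
Qed.

(** Displacements consist of at most two lattice steps, each two edges long. *)
Lemma ball_move r m v : m \in moves -> v \in hex_ball r ->
  translate (- m.2.1, - m.2.2) v \in hex_ball (r + 4).
Proof.
move=> hm /ball_reach; apply.
case: v => [[a b] t]; pose u : hex_vertex := (0, 0, t).
have -> : (a, b, t) = translate (a, b) u by rewrite /= !add0r.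
rewrite reach_translate.
rewrite (_ : translate _ _ = translate (a, b) (translate (- m.2.1, - m.2.2) u)); last first.
  by rewrite /= !add0r [a + _]addrC [b + _]addrC.
apply: map_f.
have : all (fun m => all (fun t => translate (- m.2.1, - m.2.2) (0, 0, t)
   \in reach 4 (0, 0, t)) [:: true; false]) moves by vm_compute.
by move/allP/(_ m hm)/allP; apply; case: (t).
Qed.
End Balls.

Definition move_val (chi : hex_vertex -> bool) (m : nat * seq hex_vertex * (int * int))
    (c : int * int) : Z :=
  potential potential_maps m.1.1 (map (chi \o translate c) m.1.2).

Lemma potential_bound j q : - 1000%coqZ <= potential potential_maps j q <= 1000%coqZ.
Proof.
rewrite /potential /lookup /max_potential.
by case: PositiveMap.find => [z|]; lia.
Qed.

Lemma hexagon_charge_translate chi c : hexagon_charge (chi \o translate c) =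
  \sum_(h <- hexagon) (if chi (translate c h) then 3300%coqZ else Z0) +
  \sum_(m <- moves)
    (move_val chi m c - move_val chi m (c.1 + m.2.1, c.2 + m.2.2)).
Proof.
rewrite /hexagon_charge; congr (_ + _).
rewrite /terms big_flatten big_map; apply: eq_bigr => m _.
rewrite big_cons big_seq1 /term_val /with_sign /=; congr (_ + _).
rewrite /move_val -map_comp; congr (- potential _ _ _).
by apply: eq_map => v /=; rewrite translate_translate [m.2.1 + _]addrC [m.2.2 + _]addrC.
Qed.

(** * Double counting of the charge over a ball *)

Section Counting.
Variables (X : set hex_vertex) (v0 : hex_vertex).
Hypothesis hX : identifying_code hex_adj X.
Let chi v := `[< X v >].

Definition card_ball (r : nat) : nat := size (hex_ball v0 r).
Definition card_code (r : nat) : nat := count (fun v => `[< X v >]) (hex_ball v0 r).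

Lemma ball_subset r s : (r <= s)%N -> {subset hex_ball v0 r <= hex_ball v0 s}.
Proof. by move=> rs v; apply: ball_mono. Qed.

(** 59400 = 18 * 3300: a code vertex lies on 3 hexagons, each counted 6 times. For fixed [k], [h]
    and type of [v] the vertex counted is a translate of [v] up to type, so none is counted
    twice. *)
Lemma hexagon_count r :
  \sum_(v <- hex_ball v0 r) \sum_(k <- iota 0 3) \sum_(h <- hexagon)
     (if chi (translate (centre k v) h) then 3300%coqZ else Z0) <=
  (59400%coqZ * Z.of_nat (card_code (r + 3)))%R.
Proof.
pose F v : Z := if chi v then 3300%coqZ else Z0.
pose N b := \sum_(v <- hex_ball v0 (r + 3) | v.2 == b) F v.
have F0 v : 0 <= F v by rewrite /F; case: (chi v).
have step (k : nat) (h : hex_vertex) b : (k < 3)%N -> h \in hexagon ->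
    \sum_(v <- hex_ball v0 r | v.2 == b) F (translate (centre k v) h) <= N h.2.
  move=> k3 hh.
  pose c := centre k (0, 0, b).
  (* This agrees with [translate (centre k v) h] on type [b] and, unlike that map, is visibly
     injective on both types together. *)
  pose f (v : hex_vertex) : hex_vertex :=
    (h.1.1 + c.1 + v.1.1, h.1.2 + c.2 + v.1.2, v.2 (+) b (+) h.2).
  have fE v : v.2 == b -> translate (centre k v) h = f v.
    move: v => [[x y] t] /= /eqP ->; rewrite /f addbb addFb.
    have -> : (x, y, b) = translate (x, y) (0, 0, b) by rewrite /= !add0r.
    rewrite centre_translate // -/c; move: (h) => [[i j] t'] /=.
    by rewrite !add0r !addrA.
  under eq_bigr => v vb do rewrite fE //.
  apply: sum_inj_le => //.
  - move=> [[x y] t] [[x' y'] t'] [] /addrI -> /addrI -> /addIb /addIb ->.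
    by [].
  move=> v vr vb; rewrite -fE // ball_hexagon //=.
  by move: (h) => [[i j] t'].
have split_type k h : (k < 3)%N -> h \in hexagon ->
    \sum_(v <- hex_ball v0 r) F (translate (centre k v) h) <= N h.2 + N h.2.
  move=> k3 hh; rewrite (bigID (fun v => v.2 == true)) /=; apply: lerD; first exact: step.
  by rewrite (eq_bigl (fun v => v.2 == false)) ?step // => v; case: v.2.
have NE : N false + N true = 3300%coqZ * Z.of_nat (card_code (r + 3)).
  rewrite /card_code /N; elim: (enum_fset _) => [|v s IH]; first by rewrite !big_nil.
  rewrite !big_cons [count _ _]/= -/(chi v); move: IH; rewrite /F.
  by case: (chi v); case: v.2 => /=; lia.
rewrite exchange_big /=; under eq_bigr do rewrite exchange_big /=.
have -> : (59400%coqZ * Z.of_nat (card_code (r + 3)))%R =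
    \sum_(k <- iota 0 3) \sum_(h <- hexagon) (N h.2 + N h.2).
  rewrite /hexagon /= !big_cons !big_nil /=; move: NE.
  by move: (N false) (N true) => a b; lia.
rewrite big_seq [leRHS]big_seq; apply: ler_sum => k hk.
  have k3 : (k < 3)%N by move: hk; rewrite !inE => /or3P[] /eqP->.
by rewrite big_seq [leRHS]big_seq; apply: ler_sum => h; exact: split_type.
Qed.

Lemma move_flow r m k : m \in moves -> (k < 3)%N ->
  \sum_(v <- hex_ball v0 (r + 4)) (move_val chi m (centre k v) -
     move_val chi m ((centre k v).1 + m.2.1, (centre k v).2 + m.2.2)) <=
  2000%coqZ * (Z.of_nat (card_ball (r + 4)) - Z.of_nat (card_ball r)).
Proof.
move=> hm k3; rewrite sumrB.
under [X in _ - X]eq_bigr do rewrite -centre_translate //.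
apply: (@flow_le _ _ _ (translate m.2) (translate (- m.2.1, - m.2.2))
  (fun v => move_val chi m (centre k v)) 1000%coqZ).
- exact: fset_uniq.
- exact: fset_uniq.
- by apply: ball_subset; rewrite leq_addr.
- by move=> [[a b] t]; rewrite /= !addrNK.
- by move=> v; exact: ball_move.
- by move=> v; exact: potential_bound.
Qed.

(** Each vertex of the ball of radius r + 4 sees three hexagons, of charge at least 3 * 8280 = 24840
    in all, and the flows of 36 moves for 3 values of [k] add at most 3 * 36 * 2000 = 216000 per
    boundary vertex. Dividing 24840, 59400 and 216000 by 1080 gives 23, 55 and 200. *)
Lemma card_code_ge r : (23 * card_ball (r + 4) + 200 * card_ball r <=
  55 * card_code (r + 7) + 200 * card_ball (r + 4))%N.
Proof.
have low : 24840%coqZ * Z.of_nat (card_ball (r + 4)) <=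
    \sum_(v <- hex_ball v0 (r + 4)) \sum_(k <- iota 0 3)
      hexagon_charge (chi \o translate (centre k v)).
  have -> : 24840%coqZ * Z.of_nat (card_ball (r + 4)) =
      \sum_(v <- hex_ball v0 (r + 4)) \sum_(k <- iota 0 3) 8280%coqZ.
    by rewrite /= !big_cons big_nil sum_const; congr (_ * _).
  apply: ler_sum => v _; apply: ler_sum => k _.
  by apply: hexagon_charge_ge; apply: is_code_translate; exact: is_code_identifying.
move: low; under eq_bigr do under eq_bigr do rewrite hexagon_charge_translate.
under eq_bigr do rewrite big_split /=.
rewrite big_split /= => low.
have count := hexagon_count (r + 4); rewrite -[(r + 4 + 3)%N]addnA [(4 + 3)%N]/= in count.
have flow : \sum_(v <- hex_ball v0 (r + 4)) \sum_(k <- iota 0 3) \sum_(m <- moves)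
    (move_val chi m (centre k v) -
     move_val chi m ((centre k v).1 + m.2.1, (centre k v).2 + m.2.2)) <=
    \sum_(k <- iota 0 3) \sum_(m <- moves)
    2000%coqZ * (Z.of_nat (card_ball (r + 4)) - Z.of_nat (card_ball r)).
  rewrite exchange_big /=; under eq_bigr do rewrite exchange_big /=.
  rewrite big_seq [leRHS]big_seq; apply: ler_sum => k hk.
  have k3 : (k < 3)%N by move: hk; rewrite !inE => /or3P[] /eqP->.
  by rewrite big_seq [leRHS]big_seq; apply: ler_sum => m hm; exact: move_flow.
have sm : size moves = 36%N by vm_compute.
have total := le_trans low (lerD count flow); move: total.
rewrite !sum_const sm size_iota.
move: (card_ball _) (card_ball _) (card_code _) => n4 n0 x7; lia.
Qed.
End Counting.

(** * Growth of balls and the upper limit *)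

Lemma card_ball_gt0 v0 r : (0 < card_ball v0 r)%N.
Proof.
have : v0 \in hex_ball v0 r by rewrite in_hex_ball inE; exists [::]; split.
rewrite -[v0 \in _]/(v0 \in enum_fset (hex_ball v0 r)) /card_ball.
by case: (enum_fset _).
Qed.

Lemma card_ball_le v0 r s : (r <= s)%N -> (card_ball v0 r <= card_ball v0 s)%N.
Proof. by move=> rs; apply: uniq_leq_size; [exact: fset_uniq|exact: ball_subset]. Qed.

Lemma ball_box v0 r v : v \in hex_ball v0 r ->
  (`|v.1.1 - v0.1.1| <= r)%N /\ (`|v.1.2 - v0.1.2| <= r)%N.
Proof.
rewrite in_hex_ball inE => -[p [+ + +]].
elim: p r v0 => [|w p IH] r v0 /=; first by move=> _ <- _; split; lia.
case/andP=> v0w pw lw pr; case: r pr => // r pr.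
have [] := IH r w pw lw pr.
move: v0w; rewrite hex_adjE; move: v0 w v {pw lw IH} => [[a b] t] [[a' b'] t'] [[x y] t''].
by case: t; rewrite /= !inE !xpair_eqE /= => h; lia.
Qed.

Lemma card_ball_poly v0 r : (card_ball v0 r <= 2 * (2 * r + 1) ^ 2)%N.
Proof.
pose f (v : 'I_(2 * r + 1) * 'I_(2 * r + 1) * bool) : hex_vertex :=
  (v0.1.1 - r%:Z + v.1.1%:Z, v0.1.2 - r%:Z + v.1.2%:Z, v.2).
have sub : {subset hex_ball v0 r <= map f (enum {: 'I_(2 * r + 1) * 'I_(2 * r + 1) * bool})}.
  move=> v /ball_box [h1 h2].
  have l1 : (absz (v.1.1 - v0.1.1 + r%:Z)%R < 2 * r + 1)%N by lia.
  have l2 : (absz (v.1.2 - v0.1.2 + r%:Z)%R < 2 * r + 1)%N by lia.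
  apply/mapP; exists (Ordinal l1, Ordinal l2, v.2); first by rewrite mem_enum.
  by case: v h1 h2 l1 l2 => [[a b] t] /= h1 h2 l1 l2; rewrite /f /=; congr (_, _, _); lia.
apply: leq_trans (uniq_leq_size (fset_uniq _) sub) _.
by rewrite size_map -cardE !card_prod !card_ord card_bool; lia.
Qed.

(** The cube of Bernoulli's inequality; cubic growth is enough to beat the quadratic bound on
    balls. *)
Lemma bernoulli_cube (R : realType) (e : R) (k : nat) : 0 <= e ->
  (k%:R * e) ^+ 3 <= (1 + e) ^+ (3 * k).
Proof.
move=> e0; have b n : 1 + n%:R * e <= (1 + e) ^+ n.
  elim: n => [|n IH]; first by rewrite mul0r addr0 expr0.
  rewrite exprS; apply: le_trans (ler_wpM2l _ IH); last by lra.
  have : 0 <= n%:R :> R by [].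
  rewrite -natr1; nra.
rewrite mulnC exprM; apply: lerXn2r; rewrite ?nnegrE.
- by rewrite mulr_ge0.
- by apply: exprn_ge0; lra.
- by apply: le_trans (b k); lra.
Qed.

(* Otherwise the balls would grow exponentially. *)
Lemma slow_growth (R : realType) v0 (e : R) (N : nat) : 0 < e ->
  exists2 r, (N <= r)%N &
    (card_ball v0 (r + 7))%:R <= (1 + e) * (card_ball v0 r)%:R.
Proof.
move=> e0; apply: contrapT => no.
have grow r : (N <= r)%N -> (1 + e) * (card_ball v0 r)%:R < (card_ball v0 (r + 7))%:R.
  by move=> Nr; rewrite ltNge; apply/negP => h; apply: no; exists r.
have powk k : (1 + e) ^+ k <= (card_ball v0 (N + 7 * k))%:R.
  elim: k => [|k IH]; first by rewrite expr0 muln0 addn0 ler1n card_ball_gt0.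
  rewrite exprS mulnS addnCA addnC.
  apply: le_trans _ (ltW (grow (N + 7 * k)%N (leq_addr _ _))).
  by rewrite ler_pM2l //; lra.
have poly k : (k%:R * e) ^+ 3 <= (2 * (2 * (N + 7 * (3 * k)) + 1) ^ 2)%:R.
  apply: le_trans (bernoulli_cube k (ltW e0)) _; apply: le_trans (powk _) _.
  by rewrite ler_nat card_ball_poly.
(* For k >= 1, 2 (N + 21 k) + 1 <= (2 N + 43) k, so the ball bound is at most C k^2, which k^3 e^3
   exceeds once k > C / e^3. *)
pose C : R := (2 * (2 * N + 43) ^ 2)%:R.
have [k kC] : exists k : nat, C / e ^+ 3 < k%:R.
  by exists (Num.bound (C / e ^+ 3)); apply: archi_boundP; rewrite divr_ge0 // exprn_ge0 // ltW.
have k0 : (0 < k)%N.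
  rewrite lt0n; apply/eqP => k0; move: kC; rewrite k0 ltNge => /negP; apply.
  by rewrite divr_ge0 // exprn_ge0 // ltW.
have : (2 * (2 * (N + 7 * (3 * k)) + 1) ^ 2)%:R <= C * k%:R ^+ 2 :> R.
  rewrite /C -natrX -natrM ler_nat -mulnA leq_mul2l /= -expnMn leq_sqr; nia.
move/(le_trans (poly k)).
rewrite exprMn [k%:R ^+ 3]exprS mulrAC ler_pM2r; last by rewrite exprn_gt0 // ltr0n.
by move=> h; move: kC; rewrite ltr_pdivrMr ?exprn_gt0 // ltNge h.
Qed.

(** The upper limit is an infimum of suprema over tails, so it suffices to come within every [e] of
    [t] at arbitrarily large radii. *)
Lemma density_ge (R : realType) (X : set hex_vertex) v0 (t : R) :
  (forall (e : R) N, 0 < e -> exists2 r, (N <= r)%N &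
     t - e <= (card_code X v0 r)%:R / (card_ball v0 r)%:R) ->
  (t%:E <= density R hex_adj v0 X)%E.
Proof.
move=> h; apply/ereal_infP => _ [V [N _ NV] <-].
apply/lee_addgt0Pr => e e0; have [r Nr hr] := h e N e0.
apply: (@le_trans _ _ ((card_code X v0 r)%:R / (card_ball v0 r)%:R + e)%:E).
  by rewrite lee_fin -lerBlDr.
rewrite EFinD leeD2r //; apply: ereal_sup_ubound; exists r; first exact: NV.
congr (_%:R / _%:R)%:E; rewrite /card_code.
have fin : finite_set (graph_ball hex_adj r v0 `&` X).
  by apply: finite_setIl; exact: finite_hex_ball.
rewrite -size_filter; apply: perm_size; apply: uniq_perm; first exact: fset_uniq.
  by apply: filter_uniq; exact: fset_uniq.
move=> v; rewrite in_fset_set // mem_filter -[v \in enum_fset _]/(v \in hex_ball v0 r) in_hex_ball.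
by rewrite in_setI andbC; congr (_ && _).
Qed.

Unset Implicit Arguments.

Theorem theorem1 (R : realType) (X : set hex_vertex) (v0 : hex_vertex)
    (hX : identifying_code hex_adj X) :
  ((23 / 55)%:E <= density R hex_adj v0 X)%E.
Proof.
(* With a <= b <= c the sizes of the balls of radii r, r + 4, r + 7 and x the code vertices in the
   last, 55 x >= 200 a - 177 b >= 23 c - 200 (c - a). As c - a <= d a <= d c, d = e / 4 limits the
   loss to 50 e c, below the allowed 55 e c. *)
apply: density_ge => e N e0; pose d := e / 4.
have d0 : 0 < d by rewrite divr_gt0.
have [r Nr slow] := slow_growth v0 N d0.
exists (r + 7)%N; first by rewrite (leq_trans Nr) ?leq_addr.
have a0 : 0 < (card_ball v0 (r + 7))%:R :> R by rewrite ltr0n card_ball_gt0.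
rewrite ler_pdivlMr //.
have : (23 * card_ball v0 (r + 4) + 200 * card_ball v0 r)%:R <=
    (55 * card_code X v0 (r + 7) + 200 * card_ball v0 (r + 4))%:R :> R.
  by rewrite ler_nat; exact: card_code_ge.
rewrite 2!natrD 4!natrM.
have : (card_ball v0 r)%:R <= (card_ball v0 (r + 4))%:R :> R.
  by rewrite ler_nat card_ball_le ?leq_addr.
have : (card_ball v0 (r + 4))%:R <= (card_ball v0 (r + 7))%:R :> R.
  by rewrite ler_nat card_ball_le // leq_add2l.
have : 0 < (card_ball v0 r)%:R :> R by rewrite ltr0n card_ball_gt0.
move: slow a0; rewrite /d.
move: (card_ball v0 r)%:R (card_ball v0 (r + 4))%:R (card_ball v0 (r + 7))%:R => a b c.
move: (card_code X v0 (r + 7))%:R => x; nra.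
Qed.
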